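(* Let $T$ be a tree (all of whose vertices have finite degree) with color classes $B$ and $W$, let $n$ be a positive integer, let $g: T^n \to \mathbf{R}\cup\{\infty\}$ be an L-convex function with $\mathrm{opt}(g) \neq \emptyset$, and let $x \in \mathrm{dom}\, g$. Then the total number $m$ of iterations of the steepest descent algorithm applied to $(g,x)$ is at most $d(\mathrm{opt}(g), x) + 2$. If moreover $g(x) = \min_{y \in \mathcal{F}(x)} g(y)$ or $g(x) = \min_{y \in \mathcal{I}(x)} g(y)$, then $m = d(\mathrm{opt}(g),x)$.
   Context: The vertex set of a tree $T$ is also denoted by $T$, and $d$ denotes its path metric; on $T^n$, $d(x,y) := \max_{1\le i \le n} d(x_i,y_i)$. $T$ is regarded as a bipartite graph with color classes $B$ (black) and $W$ (white). Define a partial order on $T$ by: $u \prec v$ iff $u,v$ are adjacent with $u \in W$, $v \in B$. $T^n$ carries the product order $\preceq$. For $x \in T^n$, $\mathcal{I}(x) := \{y \in T^n \mid y \preceq x\}$ and $\mathcal{F}(x) := \{y \in T^n \mid y \succeq x\}$. For $u,v \in T$ there is a unique pair $(a,b)$ of vertices with $d(u,v) = d(u,a)+d(a,b)+d(b,v)$, $d(u,a)=d(b,v)$ and $d(a,b) \le 1$. Define $u \bullet v$ and $u \circ v$ by $\{u\bullet v, u \circ v\} = \{a,b\}$ and $u \circ v \preceq u \bullet v$. On $T^n$ the operations are componentwise. A function $g: T^n \to \mathbf{R}\cup\{\infty\}$ is (alternating) L-convex if $g(x)+g(y) \ge g(x \bullet y) + g(x \circ y)$ for all $x,y \in T^n$.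 $\mathrm{dom}\, g := \{x \mid g(x) \ne \infty\}$; $\mathrm{opt}(g)$ is the set of all minimizers of $g$; $d(\mathrm{opt}(g),x) := \min\{d(y,x) \mid y \in \mathrm{opt}(g)\}$. Steepest descent algorithm with input an L-convex $g$ and a vertex $x \in \mathrm{dom}\, g$: Step 1: let $y$ be a (arbitrary) minimizer of $g$ over $\mathcal{I}(x) \cup \mathcal{F}(x)$. Step 2: if $g(x)=g(y)$, stop; otherwise set $x := y$ and go to Step 1. The number $m$ of iterations is the number of updates $x:=y$ performed, i.e. the algorithm generates $x = x^0, x^1,\ldots,x^m$ with $g(x^0)>g(x^1)>\cdots>g(x^m)$ and stops at $x^m$. *)

(* Defs.v *)
From mathcomp Require Import all_boot all_order all_algebra.
From mathcomp Require Import all_classical all_reals.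

Set Implicit Arguments.
Unset Strict Implicit.
Unset Printing Implicit Defensive.

Import Order.TTheory.

Local Open Scope classical_set_scope.

(* [0] when [A] is empty; [dist_opt] below needs [opt g] nonempty. *)
Definition nat_min (A : set nat) : nat :=
  xget 0 [set k | A k /\ forall j, A j -> k <= j].

(* A nonempty [ucycle] of a loopless graph with at most two vertices is an
   edge traversed back and forth, hence the bound in [adj_acyclic]. *)
Record bipartite_tree := BipartiteTree {
  vertex :> choiceType;
  adj : rel vertex;
  black : {pred vertex};
  white : {pred vertex};
  adj_sym : symmetric adj;
  adj_irr : irreflexive adj;
  adj_connected : forall u v, exists p, path adj u p /\ last u p = v;
  adj_acyclic : forall c, ucycle adj c -> size c <= 2;
  white_black : forall u, (u \in white) = (u \notin black);
  adj_color : forall u v, adj u v -> (u \in black) = (v \in white)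
}.

Definition locally_finite (T : bipartite_tree) : Prop :=
  forall u : T, finite_set [set v | adj u v].

Section Tree.
Variable T : bipartite_tree.
Implicit Types u v a b : T.

Definition dist u v : nat :=
  nat_min [set k | exists p, [/\ path (@adj T) u p, last u p = v & size p = k]].

Definition prec u v : bool :=
  [&& adj u v, u \in @white T & v \in @black T].

Definition preceq u v : bool := (u == v) || prec u v.

Definition mid_pair u v a b : Prop :=
  [/\ dist u v = dist u a + dist a b + dist b v,
      dist u a = dist b v & dist a b <= 1].

(* The default [(u, v)] is never used: every [u], [v] in a tree has exactly one
   such pair. *)
Definition mid_points u v : T * T := xget (u, v) [set ab | mid_pair u v ab.1 ab.2].

Definition bullet u v : T :=
  let: (a, b) := mid_points u v in if preceq a b then b else a.

Definition circ u v : T :=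
  let: (a, b) := mid_points u v in if preceq a b then a else b.

End Tree.

Section Product.
Variables (T : bipartite_tree) (n : nat).
Implicit Types x y : {ffun 'I_n -> T}.

Definition prod_dist x y : nat := \max_(i < n) dist (x i) (y i).

Definition prod_preceq x y : Prop := forall i, preceq (x i) (y i).

Definition prod_bullet x y : {ffun 'I_n -> T} := [ffun i => bullet (x i) (y i)].

Definition prod_circ x y : {ffun 'I_n -> T} := [ffun i => circ (x i) (y i)].

Definition ideal x : set {ffun 'I_n -> T} := [set y | prod_preceq y x].

Definition filtr x : set {ffun 'I_n -> T} := [set y | prod_preceq x y].

End Product.

Section Function.
Variables (T : bipartite_tree) (n : nat) (R : realType).
Implicit Types (g : {ffun 'I_n -> T} -> \bar R) (x y : {ffun 'I_n -> T}).

(* Encodes the codomain R together with +oo inside [\bar R]. *)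
Definition no_ninfty g : Prop := forall x, g x <> -oo%E.

Definition L_convex g : Prop :=
  forall x y, (g (prod_bullet x y) + g (prod_circ x y) <= g x + g y)%E.

Definition dom g : set {ffun 'I_n -> T} := [set x | g x <> +oo%E].

Definition minimizer_on (A : set {ffun 'I_n -> T}) g x : Prop :=
  A x /\ forall y, A y -> (g x <= g y)%E.

Definition opt g : set {ffun 'I_n -> T} := [set x | minimizer_on setT g x].

Definition dist_opt g x : nat :=
  nat_min [set k | exists2 y, opt g y & k = prod_dist y x].

(* The first [m] updates of some execution from [x]; [xs] is arbitrary beyond
   index [m], and the execution need not stop at [xs m]. *)
Definition sd_updates g x (m : nat) (xs : nat -> {ffun 'I_n -> T}) : Prop :=
  xs 0 = x /\
  forall k, k < m ->
    minimizer_on (ideal (xs k) `|` filtr (xs k)) g (xs k.+1) /\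
    g (xs k) <> g (xs k.+1).

Definition sd_stops g x : Prop :=
  exists2 y, minimizer_on (ideal x `|` filtr x) g y & g x = g y.

Definition sd_run g x (m : nat) (xs : nat -> {ffun 'I_n -> T}) : Prop :=
  sd_updates g x m xs /\ sd_stops g (xs m).

(* The minimizer required by an iteration always exists, so an execution never
   gets stuck. *)
Lemma sd_step_exists (lfT : locally_finite T) g x :
  exists y, minimizer_on (ideal x `|` filtr x) g y.
Proof.
pose N i := [set v | preceq (x i) v \/ preceq v (x i)].
have finN i : finite_set (N i).
  apply: (@sub_finite_set _ _ ([set x i] `|` [set v | adj (x i) v])); last first.
    by rewrite finite_setU; split; [exact: finite_set1|exact: lfT].
  move=> v [|] /orP [/eqP ->|/and3P[a _ _]]; [by left|by right|by left|].
  by right; rewrite /= adj_sym.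
have [s sP] : exists s : seq {ffun 'I_n -> T}, forall y,
    (ideal x `|` filtr x) y -> y \in s.
  have /choice [t tP] i : exists t : seq T, N i = [set` t].
    by have /finite_seqP := finN i.
  pose U := flatten [seq t i | i <- enum (ordinal n)].
  have inU y : (ideal x `|` filtr x) y -> forall i, y i \in U.
    move=> yx i; apply/flattenP; exists (t i); first by rewrite map_f ?mem_enum.
    suff : N i (y i) by rewrite tP.
    by case: yx => h; [right|left]; exact: h.
  exists [seq [ffun i => val (f i)] | f : {ffun 'I_n -> seq_sub U}].
  move=> y yx; apply/fintype.imageP; exists [ffun i => SeqSub (inU y yx i)] => //.
  by apply/ffunP => i; rewrite !ffunE.
have xx : (ideal x `|` filtr x) x by left => i; rewrite /preceq eqxx.
clear finN; move: (ideal x `|` filtr x) sP xx => A sA {N}.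
elim: s A x sA => [A y sA /sA//|z s ih A y sA Ay].
have [[w [Aw wz]]|noA] := pselect (exists w, A w /\ w <> z); last first.
  exists y; split => // v Av.
  have e u : A u -> u = z by move=> Au; apply: contrapT => uz; apply: noA; exists u.
  by rewrite (e _ Ay) (e _ Av).
have [||v [[Av vz] vP]] := ih [set u | A u /\ u <> z] w.
- by move=> u /= [/sA]; rewrite inE => /orP[/eqP|].
- by split.
have [Az|nAz] := pselect (A z); last first.
  exists v; split => // u Au; apply: vP; split => // uz; apply: nAz.
  by rewrite -uz.
have [vz'|zv] := leP (g v) (g z).
  exists v; split => // u Au; have [->//|/eqP uz] := eqVneq u z.
  by apply: vP.
exists z; split => // u Au; have [->//|/eqP uz] := eqVneq u z.
by apply: (le_trans (ltW zv)); apply: vP.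
Qed.

End Function.

(* Main.v *)
(** At a coordinate where [x] and [z] are at the maximal distance [D] and [x] has
    a given color [c], move [x] and [z] one step towards each other. Such an
    exchange does not increase [g x + g z]: for [D = 1] this is L-convexity, for
    [D = 2] it follows from L-convexity applied around a midpoint [p] of [x] and
    [z], and for [D >= 3] it is the sum of two exchanges at smaller distances,
    one between [x] and a midpoint [w'] of [x] and [z], which moves [w'] to some
    [w], and one between [w] and [z], which moves [w] back to [w'].

    Suppose that [x] minimizes [g] over one of [ideal x], [filtr x] and that [y]
    minimizes it over the other. If [z] is optimal and an exchange keeps [x] or
    [y] within the set over which it is minimal, then the exchanged [z] is
    optimal as well. A few such exchanges bring [z] to a distance from [y]
    smaller than that from [x] to [opt g]. After its first step the algorithm is
    always in this situation, so each further step decreases the distance to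
    [opt g] by exactly one. *)

Require Import Defs.
From mathcomp Require Import all_boot all_order all_algebra.
From mathcomp Require Import all_classical all_reals.
From mathcomp Require Import zify lra.

Set Implicit Arguments.
Unset Strict Implicit.
Unset Printing Implicit Defensive.

Import Order.TTheory.

Local Open Scope classical_set_scope.

Lemma nat_minP (A : set nat) k :
  A k -> A (nat_min A) /\ forall j, A j -> nat_min A <= j.
Proof.
move=> Ak; rewrite /nat_min; case: xgetP => [_ -> []//|noA].
have exA : exists i, `[< A i >] by exists k; apply/asboolP.
case: (ex_minnP exA) => i /asboolP Ai iP.
by case: (noA i); split=> // j Aj; apply: iP; apply/asboolP.
Qed.

(** * Distances, geodesics and midpoints in a tree *)

Section Geodesics.
Variable T : bipartite_tree.
Implicit Types u v w a b : T.

Notation col u := (u \in @black T).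

Lemma adj_col u v : adj u v -> col v = ~~ col u.
Proof. by move=> /adj_color ->; rewrite white_black negbK. Qed.

Lemma dist_path u v :
  exists p, [/\ path (@adj T) u p, last u p = v & size p = dist u v].
Proof.
have [p [pp pl]] := adj_connected u v.
by have [|//] := @nat_minP
  [set k | exists p, [/\ path (@adj T) u p, last u p = v & size p = k]] (size p);
  exists p.
Qed.

Lemma dist_le_size u v p : path (@adj T) u p -> last u p = v -> dist u v <= size p.
Proof.
move=> pp pl; have [|_] := @nat_minP
  [set k | exists p, [/\ path (@adj T) u p, last u p = v & size p = k]] (size p).
  by exists p.
by apply; exists p.
Qed.

Lemma distuu u : dist u u = 0.
Proof. by apply/eqP; rewrite -leqn0 (@dist_le_size u u [::]). Qed.

Lemma dist0_eq u v : dist u v = 0 -> u = v.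
Proof. by have [[|a p] [_ /= e s]] := dist_path u v; move: s; rewrite -?e // => <-. Qed.

Lemma dist_sym u v : dist u v = dist v u.
Proof.
suff le a b : dist a b <= dist b a by apply/eqP; rewrite eqn_leq !le.
have [p [pp pl <-]] := dist_path b a.
have -> : size p = size (rev (belast b p)) by rewrite size_rev size_belast.
apply: dist_le_size; last by case: p pp pl => //= c p _ <-; rewrite rev_cons last_rcons.
by rewrite -pl rev_path (eq_path (e' := @adj T)) // => ? ?; rewrite adj_sym.
Qed.

Lemma dist_triangle v u w : dist u w <= dist u v + dist v w.
Proof.
have [p [pp pl <-]] := dist_path u v; have [q [qp ql <-]] := dist_path v w.
by rewrite -size_cat dist_le_size // ?cat_path ?last_cat ?pp pl.
Qed.

Lemma adj_dist u v : adj u v -> dist u v = 1.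
Proof.
move=> uv; apply/eqP; rewrite eqn_leq (@dist_le_size u v [:: v]) /= ?uv // lt0n.
by apply/eqP => /dist0_eq e; move: uv; rewrite e adj_irr.
Qed.

Lemma dist1_adj u v : dist u v = 1 -> adj u v.
Proof.
have [p [pp pl <-]] := dist_path u v.
by case: p pp pl => [|a []] //=; rewrite andbT => ? <-.
Qed.

Lemma dist_odd u v : odd (dist u v) = col u (+) col v.
Proof.
have [p [pp pl <-]] := dist_path u v.
elim: p u pp pl => [u _ /= -> |a p ih u /= /andP[ua ap] pl]; first by rewrite addbb.
by rewrite (ih a) // (adj_col ua); case: (col u) (col v) => [] [].
Qed.

Lemma dist_gt0_nbr u v k : dist u v = k.+1 -> exists2 a, adj u a & dist a v = k.
Proof.
move=> e; have [[|a p]] := dist_path u v; rewrite e; first by case.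
case=> /= /andP[ua ap] pl [sp]; exists a => //.
apply/eqP; rewrite eqn_leq -{1}sp dist_le_size //=.
by have := dist_triangle a u v; rewrite (adj_dist ua) e add1n ltnS.
Qed.

(* Two such neighbours would be joined by a path avoiding [u], since every
   vertex on geodesics from them to [v] is closer to [v] than [u]. *)
Lemma closer_nbr_unique u v a b :
  adj u a -> adj u b -> dist a v < dist u v -> dist b v < dist u v -> a = b.
Proof.
have avoid c : dist c v < dist u v ->
    exists p, [/\ path (@adj T) c p, last c p = v & u \notin c :: p].
  have [p [pp pl sp]] := dist_path c v; move=> lt; exists p; split=> //.
  apply/negP => up; have [i ile e] : exists2 i, i <= size p & u = nth u (c :: p) i.
    by exists (index u (c :: p)); rewrite ?nth_index // -ltnS index_mem.
  have : dist u v <= size (drop i p).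
    move: pp pl; rewrite -{1 2}(cat_take_drop i p) cat_path last_cat => /andP[_].
    have -> : last c (take i p) = u.
      by rewrite (last_nth u) size_takel // -[_ :: take _ _]/(take i.+1 (c :: p)) nth_take.
    exact: dist_le_size.
  by rewrite size_drop; lia.
move=> ua ub /avoid[p [pp pl up]] /avoid[q [qp ql uq]]; apply/eqP/negPn/negP => ab.
have [r [rp rl ur]] : exists r, [/\ path (@adj T) a r, last a r = b & u \notin a :: r].
  exists (p ++ rev (belast b q)); split.
  - rewrite cat_path pp pl -ql rev_path (eq_path (e' := @adj T)) // => ? ?.
    by rewrite adj_sym.
  - rewrite last_cat pl -ql; case: q {qp ql uq} => //= c q.
    by rewrite rev_cons last_rcons.
  - rewrite -cat_cons mem_cat negb_or up mem_rev; apply: contra uq; exact: mem_belast.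
case: (shortenP rp) rl ur => r' r'p r'u r'r r'l ur.
(* This cycle has more than two vertices unless [r'] is empty, and then [a = b]. *)
have /adj_acyclic : ucycle (@adj T) (u :: a :: r').
  rewrite /ucycle cons_uniq r'u andbT /= rcons_path ua r'p r'l adj_sym ub /=.
  by rewrite inE; apply: contra ur; rewrite !inE => /orP[->//|/r'r ->]; rewrite orbT.
by case: r' r'l {r'p r'u r'r} => //= e; rewrite e eqxx in ab.
Qed.

(** By [closer_nbr_unique] both geodesics leave [u] through the same neighbour, from which the
    induction continues. *)
Lemma geodesic_unique u v a b :
  dist u a + dist a v = dist u v -> dist u b + dist b v = dist u v ->
  dist u a = dist u b -> a = b.
Proof.
move: {2}(dist u a) (erefl (dist u a)) => k; elim: k u => [|k ih] u ea av bv e.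
  by rewrite -(dist0_eq ea); apply: dist0_eq; rewrite -e.
have [c uc ca] := dist_gt0_nbr ea; have [c' uc'] : exists2 c', adj u c' & dist c' b = k.
  by apply: dist_gt0_nbr; rewrite -e.
have := dist_triangle a c v; have := dist_triangle b c' v.
have := dist_triangle c u v; have := dist_triangle c' u v.
rewrite (adj_dist uc) (adj_dist uc') => *.
have ec : c = c' by apply: (@closer_nbr_unique u v) => //; lia.
by subst c'; apply: (ih c); lia.
Qed.

(* The [k]-th vertex of the geodesic from [u] to [v]; it is [v] when [k]
   exceeds [dist u v]. *)
Definition geo u v k : T :=
  xget u [set a | dist u a = minn k (dist u v) /\ dist a v = dist u v - k].

Lemma geo_spec u v k :
  dist u (geo u v k) = minn k (dist u v) /\ dist (geo u v k) v = dist u v - k.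
Proof.
rewrite /geo; case: xgetP => [? -> []//|noa].
have [p [pp pl sp]] := dist_path u v.
(* The first [k] steps of a shortest path end at a witness: the triangle inequality turns both upper
   bounds into equalities. *)
case: (noa (last u (take k p))).
have := dist_triangle (last u (take k p)) u v.
have : dist u (last u (take k p)) <= minn k (dist u v).
  rewrite -sp -size_take_min.
  move: pp; rewrite -{1}(cat_take_drop k p) cat_path => /andP[p1 _].
  exact: dist_le_size p1 erefl.
have : dist (last u (take k p)) v <= dist u v - k.
  rewrite -sp -size_drop; move: pp pl.
  rewrite -{1 2}(cat_take_drop k p) cat_path last_cat => /andP[_]; exact: dist_le_size.
by rewrite /=; lia.
Qed.


Lemma geo_eq u v a k :
  dist u a = k -> k + dist a v = dist u v -> geo u v k = a.
Proof.
by move=> ua uav; have [? ?] := geo_spec u v k; apply: (@geodesic_unique u v); lia.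
Qed.

Lemma geo0 u v : geo u v 0 = u.
Proof. by apply: geo_eq; rewrite ?distuu. Qed.

Lemma geo_dist u v : geo u v (dist u v) = v.
Proof. by apply: geo_eq; rewrite ?distuu ?addn0. Qed.

Lemma geo_sym u v k : k <= dist u v -> geo v u k = geo u v (dist u v - k).
Proof.
move=> kd; have [? ?] := geo_spec u v (dist u v - k).
by apply: geo_eq; rewrite ![dist v _]dist_sym ?[dist _ u]dist_sym; lia.
Qed.

Lemma col_geo u v k : k <= dist u v -> col (geo u v k) = col u (+) odd k.
Proof.
move=> kd; have [e _] := geo_spec u v k.
by have := dist_odd u (geo u v k); rewrite e (minn_idPl kd) => ->; rewrite addKb.
Qed.

Lemma dist_geo u v i j :
  i <= j <= dist u v -> dist (geo u v i) (geo u v j) = j - i.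
Proof.
move=> ijd; have [? ?] := geo_spec u v j.
have [? ?] := geo_spec u (geo u v j) i.
have := dist_triangle (geo u v j) (geo u (geo u v j) i) v.
have := dist_triangle (geo u (geo u v j) i) u v.
by move=> *; rewrite (@geo_eq u v (geo u (geo u v j) i)) //; lia.
Qed.

Lemma geo_geo u v i j k : i <= j <= dist u v ->
  geo (geo u v i) (geo u v j) k = geo u v (i + minn k (j - i)).
Proof.
move=> ijd; set m := minn k (j - i).
have -> : geo (geo u v i) (geo u v j) k = geo (geo u v i) (geo u v j) m.
  have [? ?] := geo_spec (geo u v i) (geo u v j) k.
  have e := dist_geo ijd.
  by symmetry; apply: geo_eq; lia.
by apply: geo_eq; rewrite !dist_geo; lia.
Qed.

(* Colors are encoded as booleans, [true] being black. *)
Definition op (c : bool) u v := if c then bullet u v else circ u v.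

Lemma op_mid_pair c u v : exists a b,
  mid_pair u v a b /\ op c u v = if col b == c then b else a.
Proof.
have [ab] : exists ab, [/\ mid_pair u v ab.1 ab.2 & mid_points u v = ab].
  rewrite /mid_points; case: xgetP => [ab _ abP|noab]; first by exists ab.
  (* Rounding half the length of the geodesic down and up gives a mid pair. *)
  pose d := dist u v; case: (noab (geo u v d./2, geo u v (uphalf d))).
  have [? ?] := geo_spec u v d./2; have [? ?] := geo_spec u v (uphalf d).
  by split=> /=; rewrite ?dist_geo; lia.
case: ab => a b /= [abP e]; exists a, b; split=> //.
rewrite /op /bullet /circ e /preceq /prec white_black.
case: eqP => [->|ab]; first by rewrite !if_same.
have /adj_col -> : adj a b.
  by apply: dist1_adj; case: abP => _ _; case E: (dist a b) => [|[]] // _; move/dist0_eq: E.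
case: abP => _ _; case E : (dist a b) => [|[|]] // _; first by move/dist0_eq: E.
by rewrite (dist1_adj E); case: c (col a) => [] [].
Qed.

(** On a geodesic starting at [u], the vertices of color [c] are those whose index has parity
    [col u (+) c]; this is the [b] for which [op c] selects index [mid_index b d]. For even [d] the
    two candidates coincide. *)
Definition mid_index (b : bool) d := if odd (uphalf d) == b then uphalf d else d./2.

Lemma opE c u v : op c u v = geo u v (mid_index (col u (+) c) (dist u v)).
Proof.
have [a [b [[e ua ab] ->]]] := op_mid_pair c u v.
set d := dist u v in e *.
have <- : geo u v (uphalf d) = b.
  have := dist_triangle a u b; have := dist_triangle b u v.
  by move=> *; apply: geo_eq; rewrite -/d; lia.
have <- : geo u v d./2 = a.
  have := dist_triangle b a v; have := dist_triangle a u v.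
  by move=> *; apply: geo_eq; rewrite -/d; lia.
rewrite /mid_index col_geo -/d; last by lia.
by case: ifP => h; case: ifP => h' //; lia.
Qed.

(** For vertices of one geodesic, [op] and [push] become arithmetic on indices; the later identities
    are proved in this form. *)
Lemma op_geo c u v i j : i <= j <= dist u v ->
  op c (geo u v i) (geo u v j) = geo u v (i + mid_index (col u (+) odd i (+) c) (j - i)).
Proof.
move=> ijd; rewrite opE geo_geo // dist_geo // col_geo; last by lia.
by congr (geo u v (i + _)); apply/minn_idPl; rewrite /mid_index; case: ifP; lia.
Qed.

Lemma op_sym c u v : op c u v = op c v u.
Proof.
have d0 := dist_odd u v.
rewrite !opE [dist v u]dist_sym [RHS]geo_sym /mid_index; last by case: ifP; lia.
by congr (geo u v _); case: ifP => h; case: ifP => h'; lia.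
Qed.

(** It is paired with [push D (c (+) odd D) v u]: at distance [D], the vertex [v] has color
    [c (+) odd D] exactly when [u] has color [c], so both move or neither does. *)
Definition push D (c : bool) u v :=
  if (dist u v == D) && (col u == c) then geo u v 1 else u.

(** The [minn] has an effect only for [D = 0], where there is no room for a step. *)
Lemma push_geo D c u v i j : i <= j <= dist u v ->
  push D c (geo u v i) (geo u v j) =
  geo u v (i + minn ((j - i == D) && (col u (+) odd i == c)) (j - i)).
Proof.
move=> ijd; rewrite /push dist_geo // col_geo; last by lia.
by case: ifP => _; rewrite ?geo_geo // min0n addn0.
Qed.

Lemma push_geo_rev D c u v i j : i <= j <= dist u v ->
  push D c (geo u v j) (geo u v i) =
  geo u v (j - minn ((j - i == D) && (col u (+) odd j == c)) (j - i)).
Proof.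
move=> ijd; rewrite /push dist_sym dist_geo // col_geo; last by lia.
case: ifP => _; rewrite ?min0n ?subn0 //.
have [->|ij] := eqVneq i j.
  by rewrite geo_geo; [congr (geo u v _)|]; lia.
rewrite geo_sym dist_geo // ?geo_geo //; last by lia.
by congr (geo u v _); lia.
Qed.

End Geodesics.

Lemma mid_index_le b d : mid_index b d <= d.
Proof. by rewrite /mid_index; case: ifP; lia. Qed.

Lemma mid_index_half b d : d./2 <= mid_index b d /\ mid_index b d <= uphalf d.
Proof. by rewrite /mid_index; case: ifP; lia. Qed.

(* In [push_halves] below, [d] is the length of the geodesic from [u] to [v], [p]
   the color of [u], and [a] and [a - S] are the indices on it of [w'] and [w].
   The conditions under which the pushes there move a vertex are all shown to
   amount to [S]. *)
Section HalvingIndices.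
Variables (D d : nat) (p c : bool).
Hypotheses (D0 : 0 < D) (uD : d <= D).
Let S := (d == D) && (p == c).
Let e := uphalf D.
Let a := mid_index (p (+) (c (+) odd e (+) ~~ odd D)) d.

Lemma upper_half : (a == e) && (p == c) = S.
Proof.
rewrite /S; case: (eqVneq p c) => [pc|]; rewrite ?andbF // !andbT.
rewrite /a /mid_index pc; have [->|dD] := eqVneq d D.
  by rewrite /e; case: c; case: ifP; lia.
by rewrite /e; case: c; case: ifP; lia.
Qed.

Lemma upper_half_rev : (a == e) && (p (+) odd a == c (+) odd e) = S.
Proof.
by rewrite -upper_half; case: eqP => //= ->; case: p (c) (odd e) => [] [] [].
Qed.

Lemma endpoint_half : (d == D) && (p (+) odd d == c (+) odd D) = S.
Proof. by rewrite /S; case: eqP => //= ->; case: p (c) (odd D) => [] [] []. Qed.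

(** If [d < D] then [S] is false, and the remaining length [d - a <= uphalf d] is at most
    [D - e]. *)
Lemma lower_half_inv : (d - (a - S) == D - e + 1) -> d = D.
Proof.
have [+ _] : _ := mid_index_half (p (+) (c (+) odd e (+) ~~ odd D)) d; rewrite -/a.
by rewrite /S /e; have [//|dD] := eqVneq d D => /=; lia.
Qed.

Lemma lower_half_dist : d = D -> p = c -> d - (a - S) = D - e + 1.
Proof.
rewrite /S /a /mid_index /e => -> ->; rewrite !eqxx.
by case: c; case: ifP; lia.
Qed.

Lemma lower_half_rev : (d - (a - S) == D - e + 1) && (p (+) odd d == c (+) odd D) = S.
Proof.
rewrite /S; apply/idP/idP => [/andP[/lower_half_inv -> pc]|/andP[/eqP dD /eqP pc]].
  by rewrite eqxx; move: pc; case: p c (odd D) => [] [] [].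
by move: (lower_half_dist dD pc); rewrite /S => ->; rewrite dD pc !eqxx.
Qed.

Lemma lower_half : (d - (a - S) == D - e + 1) && (p (+) odd (a - S) == c (+) ~~ odd e) = S.
Proof.
rewrite -[RHS]lower_half_rev; case: eqP => //= dS; have dD : d = D by apply: lower_half_inv; apply/eqP.
have -> : odd (a - S) = ~~ odd e.
  have -> : a - S = e.-1 by move: dS; rewrite dD /e; lia.
  by rewrite /e; lia.
by rewrite dD; case: p c (odd D) (odd e) => [] [] [] [].
Qed.
End HalvingIndices.

(** * Identities for pushes between two vertices of the tree *)

Section PushesOnGeodesics.
Variable T : bipartite_tree.
Implicit Types u v w a b : T.

Notation col u := (u \in @black T).

(** Across an edge, moving the end of color [c] onto the other one leaves a vertex of color
    [~~ c]. *)
Lemma push_le1 c u v : dist u v <= 1 ->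
  push 1 c u v = op (~~ c) u v /\ push 1 (~~ c) v u = op c u v.
Proof.
move=> d1.
have := @push_geo_rev T 1 (~~ c) u v 0 (dist u v).
have := @push_geo T 1 c u v 0 (dist u v).
have := @op_geo T c u v 0 (dist u v); have := @op_geo T (~~ c) u v 0 (dist u v).
rewrite geo0 geo_dist leqnn => -> // -> // -> // -> //.
by rewrite /mid_index; split; congr (geo u v _); case: ifP; lia.
Qed.

(** The pushes are one half of what L-convexity yields for [(u, p)] and for [(v, p)]. Applied to the
    other two halves, it gives back [p] twice, which lets the auxiliary values cancel. *)
Lemma push_le2 c u v (p := op c u v) : dist u v <= 2 ->
  [/\ push 2 c u v = op (~~ c) u p, push 2 c v u = op (~~ c) v p,
      op c (op c u p) (op c v p) = p & op (~~ c) (op c u p) (op c v p) = p].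
Proof.
move=> d2; set d := dist u v in d2.
have f_op c' i j : i <= j <= d -> _ := @op_geo T c' u v i j.
have f_push := @push_geo T 2 c u v 0 d.
have f_push' := @push_geo_rev T 2 c u v 0 d.
rewrite geo0 geo_dist in f_push f_push'.
have := f_op c 0 d (leqnn d); rewrite geo0 geo_dist -/p subn0 add0n addbF => pE.
set m := mid_index _ d in pE; have mE : m = mid_index (col u (+) c) d by [].
have md : m <= d by rewrite mE /mid_index; case: ifP; lia.
have up c' := f_op c' 0 m; rewrite geo0 -pE in up.
have vp c' := f_op c' m d; rewrite geo_dist -pE in vp.
have vp' c' : op c' v p = op c' p v by rewrite op_sym.
rewrite !vp' !up ?vp ?f_push ?f_push' ?leqnn //; try lia.
have le1 := mid_index_le (col u (+) odd 0 (+) c) (m - 0).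
have le2 := mid_index_le (col u (+) odd m (+) c) (d - m).
rewrite !f_op; [|lia|lia]; rewrite pE.
(* What is left is a finite check over [d <= 2] and the colors. *)
suff nat_eq (b : bool) : let m := mid_index (b (+) c) d in
    [/\ 0 + minn ((d - 0 == 2) && (b (+) odd 0 == c)) (d - 0) =
         0 + mid_index (b (+) odd 0 (+) ~~ c) (m - 0),
        d - minn ((d - 0 == 2) && (b (+) odd d == c)) (d - 0) =
        m + mid_index (b (+) odd m (+) ~~ c) (d - m) &
        forall c', let i := 0 + mid_index (b (+) odd 0 (+) c) (m - 0) in
        i + mid_index (b (+) odd i (+) c') (m + mid_index (b (+) odd m (+) c) (d - m) - i) = m].
  by have [-> -> e] := nat_eq (col u); split=> //; congr (geo u v _); apply: e.
move: d d2 b {f_op f_push f_push' m pE mE md up vp le1 le2}; clear.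
by case: c => [] [|[|[|]]] //= _ []; split=> // [] [].
Qed.

(* From a [u] of color [c], the color in [w'] selects the middle vertex at distance
   [e] if [dist u v = D] is odd, but the one at distance [e - 1] if
   [dist u v = D - 1] is odd, so that [u] is not pushed in that case. *)
Lemma push_halves D c u v (e := uphalf D)
    (w' := op (c (+) odd e (+) ~~ odd D) u v)
    (w := push e (c (+) odd e) w' u) : 0 < D -> dist u v <= D ->
  [/\ dist u w' <= e, dist w v <= D - e + 1,
      push e c u w' = push D c u v,
      push (D - e + 1) (c (+) ~~ odd e) w v = w' &
      push (D - e + 1) (c (+) odd D) v w = push D (c (+) odd D) v u].
Proof.
move=> D0 uD; set d := dist u v in uD.
have f_op c' i j : i <= j <= d -> _ := @op_geo T c' u v i j.
have f_push D' c' i j : i <= j <= d -> _ := @push_geo T D' c' u v i j.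
have f_push' D' c' i j : i <= j <= d -> _ := @push_geo_rev T D' c' u v i j.
set c0 := c (+) odd e (+) ~~ odd D in w' w *.
have w'E : w' = geo u v (mid_index (col u (+) c0) d).
  by have := f_op c0 0 d (leqnn d); rewrite geo0 geo_dist subn0 add0n addbF => <-.
set a := mid_index _ d in w'E.
have ad : a <= d by exact: mid_index_le.
have wE := f_push' e (c (+) odd e) 0 a; rewrite geo0 -w'E -/w in wE.
set b := a - minn _ _ in wE; have {}wE : w = geo u v b by exact: wE.
set S := (d == D) && (col u == c).
(* Since [a > 0] under [S], the truncated difference [a - S] below is a genuine step back. *)
have aS : S -> [/\ 0 < a, a = e & d = D].
  move=> SP; move: (SP); rewrite {1}/S -(upper_half (col u) c D0 uD) => /andP[/eqP + _].
  rewrite -/a -/e => ae; split=> //; last by case/andP: SP => /eqP.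
  by rewrite ae /e; case: (D) D0.
have bE : b = a - S.
  rewrite /b subn0 (upper_half_rev (col u) c D0 uD) -/S.
  by case: (S) aS => [/(_ isT)[a0 _ _]|_] /=; rewrite ?min0n // (minn_idPl a0).
have bd : b <= d by apply: leq_trans ad; rewrite bE leq_subr.
have f_uw := f_push e c 0 a; rewrite geo0 -w'E in f_uw.
have f_uv := f_push D c 0 d; rewrite geo0 geo_dist in f_uv.
have f_wv := f_push (D - e + 1) (c (+) ~~ odd e) b d; rewrite -wE geo_dist in f_wv.
have f_vw := f_push' (D - e + 1) (c (+) odd D) b d; rewrite -wE geo_dist in f_vw.
have f_vu := f_push' D (c (+) odd D) 0 d; rewrite geo0 geo_dist in f_vu.
have duw : dist u w' = a.
  by have := @dist_geo T u v 0 a ad; rewrite geo0 -w'E subn0.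
have dwv : dist w v = d - b.
  by have := @dist_geo T u v b d; rewrite geo_dist -wE bd leqnn; apply.
rewrite duw dwv f_uw // f_uv ?f_wv ?f_vw ?f_vu ?bd ?leqnn // w'E.
rewrite !subn0 !add0n addbF (upper_half (col u) c D0 uD) bE.
rewrite (lower_half (col u) c D0 uD) (lower_half_rev (col u) c D0 uD).
rewrite endpoint_half -/S.
have lo : d./2 <= a by exact: (mid_index_half _ d).1.
have hi : a <= uphalf d by exact: (mid_index_half _ d).2.
case: (S) aS => [/(_ isT)[a0 ae dD]|_] /=; last first.
  rewrite !min0n subn0 addn0; split=> //; clear -lo hi uD D0; rewrite /e; lia.
split; first by rewrite ae.
- by rewrite dD ae /e; clear -D0; lia.
- by rewrite !(minn_idPl _) //; apply: leq_trans ad.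
- by rewrite (minn_idPl _) ?subnK // subn_gt0 subn1 prednK.
- by rewrite !(minn_idPl _) // ?subn_gt0 ?(leq_trans a0) // subn1 prednK.
Qed.

End PushesOnGeodesics.

(** * Cancellation with possibly infinite values *)

Section Cancellation.
Variable R : realType.
Local Open Scope ereal_scope.

(** When [x + z] is finite, the first inequality makes [w'] finite and the second then [w], so both
    cancel in the sum of the last two. *)
Lemma lee_chain2 (x z x' z' w w' w'' : \bar R) :
  x <> -oo -> z <> -oo -> x' <> -oo -> z' <> -oo ->
  w <> -oo -> w' <> -oo -> w'' <> -oo ->
  w' + w'' <= x + z -> x' + w <= x + w' -> w' + z' <= w + z -> x' + z' <= x + z.
Proof.
move: x z x' z' w w' w'' => [x| |] [z| |] [x'| |] [z'| |] [w| |] [w'| |] [w''| |] //=;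
  rewrite -?EFinD ?lee_fin ?addye ?addey ?leey //=; do ?[by move=> *; lra].
Qed.

Lemma lee_chain3 (x z x' z' x'' z'' p q : \bar R) :
  x <> -oo -> z <> -oo -> x' <> -oo -> z' <> -oo ->
  x'' <> -oo -> z'' <> -oo -> p <> -oo -> q <> -oo ->
  p + q <= x + z -> x'' + x' <= x + p -> z'' + z' <= z + p -> p + p <= x'' + z'' ->
  x' + z' <= x + z.
Proof.
have [-> *|] := eqVneq (x + z) +oo; first exact: leey.
move: x z => [x| |] [z| |] //= _ + + + + + + + +; rewrite -?EFinD //.
move: p q => [p| |] [q| |] //= + + + + + + + +; rewrite -?EFinD ?addye ?addey ?leye_eq //=.
move: x' x'' => [x'| |] [x''| |] //= + + + + + + + +; rewrite -?EFinD ?addye ?addey ?leye_eq //=.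
move: z' z'' => [z'| |] [z''| |] //= + + + + + + + +; rewrite -?EFinD ?addye ?addey ?leye_eq //=.
by rewrite !lee_fin; lra.
Qed.

End Cancellation.

(** * The exchange inequality *)

Section Exchange.
Variables (T : bipartite_tree) (n : nat) (R : realType).
Variable g : {ffun 'I_n -> T} -> \bar R.
Hypotheses (g_ninfty : no_ninfty g) (g_convex : L_convex g).
Implicit Types x y z : {ffun 'I_n -> T}.

Definition prod_op c x y := [ffun i => op c (x i) (y i)].

Definition prod_push D c x y := [ffun i => push D c (x i) (y i)].

Lemma L_convex_op c x y :
  (g (prod_op c x y) + g (prod_op (~~ c) x y) <= g x + g y)%E.
Proof. by case: c; last rewrite addeC; exact: g_convex. Qed.

(* Analogue on trees of the translation-submodularity of L-natural-convex
   functions. *)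
Lemma exchange D c x z : 0 < D -> (forall i, dist (x i) (z i) <= D) ->
  (g (prod_push D c x z) + g (prod_push D (c (+) odd D) z x) <= g x + g z)%E.
Proof.
elim/ltn_ind: D c x z => -[|[|[|D]]] // ih c x z _ xz.
- have := L_convex_op (~~ c) x z; rewrite negbK addbT.
  congr (g _ + g _ <= _)%E; apply/ffunP => i; rewrite !ffunE.
    by have [-> _] := push_le1 c (xz i).
  by have [_ ->] := push_le1 c (xz i).
- set p := prod_op c x z; set x2 := prod_op c x p; set z2 := prod_op c z p.
  have [e1 e2 e3 e4] : [/\ prod_push 2 c x z = prod_op (~~ c) x p,
      prod_push 2 c z x = prod_op (~~ c) z p,
      prod_op c x2 z2 = p & prod_op (~~ c) x2 z2 = p].
    by split; apply/ffunP => i; rewrite !ffunE; have [] := push_le2 c (xz i).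
  rewrite addbF e1 e2.
  apply: (@lee_chain3 _ _ _ _ _ (g x2) (g z2) (g p) (g (prod_op (~~ c) x z)));
    try exact: g_ninfty; try exact: L_convex_op.
  by have := L_convex_op c x2 z2; rewrite e3 e4.
set E := D.+3 in xz *; set e := uphalf E.
set w' := prod_op (c (+) odd e (+) ~~ odd E) x z.
set w := prod_push e (c (+) odd e) w' x.
have H i := @push_halves T E c (x i) (z i) isT (xz i).
(* Both distances are below [E] because [E >= 3]; from distance 2 the second would be 2 again, hence
   the separate case above. *)
have eE : e < E /\ 0 < e by rewrite /e /E; lia.
have eE' : E - e + 1 < E /\ 0 < E - e + 1 by rewrite /e /E; lia.
apply: (@lee_chain2 _ _ _ _ _ (g w) (g w')
  (g (prod_op (~~ (c (+) odd e (+) ~~ odd E)) x z))); try exact: g_ninfty.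
- exact: L_convex_op.
- have := ih e eE.1 c x w' eE.2; rewrite -/w.
  have -> : prod_push e c x w' = prod_push E c x z.
    by apply/ffunP => i; rewrite !ffunE; have [] := H i.
  by apply=> i; rewrite !ffunE; have [] := H i.
have := ih _ eE'.1 (c (+) ~~ odd e) w z eE'.2.
have -> : c (+) ~~ odd e (+) odd (E - e + 1) = c (+) odd E.
  have -> : odd (E - e + 1) = odd E (+) ~~ odd e by rewrite /e /E; lia.
  by rewrite -addbA; congr (_ (+) _); case: (odd e) (odd E) => [] [].
have -> : prod_push (E - e + 1) (c (+) ~~ odd e) w z = w'.
  by apply/ffunP => i; rewrite !ffunE; have [] := H i.
have -> : prod_push (E - e + 1) (c (+) odd E) z w = prod_push E (c (+) odd E) z x.
  by apply/ffunP => i; rewrite !ffunE; have [] := H i.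
by apply=> i; rewrite !ffunE; have [] := H i.
Qed.

End Exchange.

(** * Moving an optimal point by exchanges *)

Section Descent.
Variables (T : bipartite_tree) (n : nat) (R : realType).
Variable g : {ffun 'I_n -> T} -> \bar R.
Hypotheses (g_ninfty : no_ninfty g) (g_convex : L_convex g).
Implicit Types x y z : {ffun 'I_n -> T}.

Notation col u := (u \in @black T).

(** Black vertices are the maximal ones, so [c = true] gives the ideal and [c = false] the filter;
    the color parameter treats both at once. *)
Definition star c x : set {ffun 'I_n -> T} :=
  [set y | forall i, y i = x i \/ adj (x i) (y i) /\ col (x i) = c].

Lemma star_ideal x : star true x = ideal x.
Proof.
apply/seteqP; split=> y yx i; have := yx i; rewrite /= /preceq /prec white_black.
  by case=> [->|[xy cx]]; rewrite ?eqxx // adj_sym xy cx (adj_col xy) cx orbT.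
by case/predU1P => [|/and3P[yx' _ ?]]; [left|right; rewrite adj_sym].
Qed.

Lemma star_filtr x : star false x = filtr x.
Proof.
apply/seteqP; split=> y yx i; have := yx i; rewrite /= /preceq /prec white_black.
  by case=> [->|[xy cx]]; rewrite ?eqxx // xy cx (adj_col xy) cx orbT.
by case/predU1P => [|/and3P[xy /negPf ? _]]; [left|right].
Qed.

Lemma star_refl c x : star c x x.
Proof. by move=> i; left. Qed.

(** A coordinate that moved from [x] to [y] has color [~~ c] in [y] and cannot move again. *)
Lemma star_trans c x y z : star c x y -> star c y z -> star c x z.
Proof.
move=> xy yz i; have [yx|[xy' cx]] := xy i; first by have := yz i; rewrite yx.
have [->|[_]] := yz i; first by right.
by rewrite (adj_col xy') cx; case: c {xy yz cx}.
Qed.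

Lemma star_dist c x y i : star c x y -> dist (x i) (y i) <= 1.
Proof. by move=> /(_ i)[->|[/adj_dist -> _]]; rewrite ?distuu. Qed.

Lemma star_union c x : ideal x `|` filtr x = star c x `|` star (~~ c) x.
Proof. by rewrite -star_ideal -star_filtr; case: c => //=; rewrite setUC. Qed.

Lemma adj_geo1 (u v : T) : 0 < dist u v -> adj u (geo u v 1).
Proof. by move=> uv; apply: dist1_adj; have [-> _] := geo_spec u v 1; lia. Qed.

(** The pushed [y] stays in [A], so its value is at least [g y]; as [g y] is finite, the exchange
    inequality keeps the value at [z] from rising. *)
Lemma push_opt A D c y z : minimizer_on A g y -> dom g y -> opt g z ->
  0 < D -> (forall i, dist (y i) (z i) <= D) -> A (prod_push D c y z) ->
  opt g (prod_push D (c (+) odd D) z y).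
Proof.
move=> [_ ymin] ydom [_ zmin] D0 yz Ay'; split=> // t _.
apply: le_trans (zmin t I).
have yfin : g y \is a fin_num by rewrite fin_numE; apply/andP; split; apply/eqP.
rewrite -(@leeD2lE _ (g y)) //; apply: le_trans (exchange g_ninfty g_convex c D0 yz).
by apply: leeD2r; apply: ymin.
Qed.

Lemma push_cases D c (u v : T) :
  [/\ dist u v = D, col u = c, push D c u v = geo u v 1 &
      push D (c (+) odd D) v u = geo v u 1] \/
  [/\ dist u v = D -> col u <> c, push D c u v = u & push D (c (+) odd D) v u = v].
Proof.
rewrite /push [dist v u]dist_sym; have uv := dist_odd u v.
case: eqP uv => [-> uv|nD _]; last by right; split=> // /nD.
have -> : (col v == c (+) odd D) = (col u == c).
  by rewrite uv; case: (col u) (col v) c => [] [] [].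
by case: eqP => [cu|ncu]; [left|right].
Qed.

(** Where [y] has color [c] it still agrees with [x], so pushing it there stays in [star c x]. *)
Lemma push_round c x y z D : minimizer_on (star c x) g y -> dom g y -> opt g z ->
  (forall i, dist (y i) (z i) <= D.+1) ->
  exists z', [/\ opt g z', forall i, dist (y i) (z' i) <= D.+1,
    forall i, col (y i) = c -> dist (y i) (z' i) <= D &
    forall i, col (y i) <> c -> z' i = z i].
Proof.
move=> ymin ydom zopt yz; exists (prod_push D.+1 (c (+) odd D.+1) z y).
have H i := @push_cases D.+1 c (y i) (z i).
split.
- apply: (push_opt ymin ydom zopt _ yz) => // i; rewrite ffunE.
  have [[yzD cy -> _]|[_ -> _]] := H i; last by have [yx _] := ymin; apply: yx.
  right; have [yx _] := ymin; have [e|[xy cx]] := yx i.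
    by rewrite -e; split=> //; apply: adj_geo1; rewrite yzD.
  by move: cy; rewrite (adj_col xy) cx; case: (c).
- move=> i; rewrite ffunE; have [[yzD _ _ ->]|[_ _ ->]] := H i; last exact: yz.
  by have [_] := geo_spec (z i) (y i) 1; rewrite dist_sym [dist (z i) _]dist_sym; lia.
- move=> i cy; rewrite ffunE; have [[yzD _ _ ->]|[ncy _ ->]] := H i.
    by have [_] := geo_spec (z i) (y i) 1; rewrite dist_sym [dist (z i) _]dist_sym; lia.
  by have := yz i; rewrite leq_eqVlt => /orP[/eqP/ncy/(_ cy)|].
- by move=> i cy; rewrite ffunE; have [[]|[]] := H i.
Qed.

(* Each of the four exchanges below moves [x] or [y] within the star over which
   it is minimal, so that the other point it produces remains optimal. *)
Lemma opt_closer_after_step c x y z D : dom g x ->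
  minimizer_on (star c x) g x -> minimizer_on (star (~~ c) x) g y -> opt g z ->
  (forall i, dist (x i) (z i) <= D.+1) ->
  exists2 z', opt g z' & forall i, dist (y i) (z' i) <= D.
Proof.
move=> xdom xmin ymin z_opt xz.
have [ystar yle] := ymin.
have ydom : dom g y.
  move=> e; apply: xdom; apply/eqP; rewrite -leye_eq -e; apply: yle; exact: star_refl.
(* Coordinates of color [c] do not move in the step to [y]; they are brought within [D] now, since
   [x] may be pushed there. *)
have [z1 [z1opt xz1 xz1c _]] := push_round xmin xdom z_opt xz.
(* Where [y] is at distance [D.+2] from [z1], its geodesic to [z1] starts through [x], so pushing
   [y] takes it back to [x]. *)
pose z2 := prod_push D.+2 (c (+) odd D.+2) z1 y.
have odd_adj (u v w : T) : adj u v -> odd (dist v w) = ~~ odd (dist u w).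
  by move=> uv; rewrite !dist_odd (adj_col uv) addNb.
have step i : y i = x i \/ [/\ adj (x i) (y i), col (x i) = ~~ c & col (y i) = c].
  have [|[xy cx]] := ystar i; first by left.
  by right; split=> //; rewrite (adj_col xy) cx negbK.
have H1 i := @push_cases D.+2 c (y i) (z1 i).
have far i : dist (y i) (z1 i) = D.+2 ->
    [/\ adj (x i) (y i), dist (x i) (z1 i) = D.+1 & geo (y i) (z1 i) 1 = x i].
  move=> e; have [yx|[xy _ _]] := step i; first by have := xz1 i; rewrite -yx e ltnn.
  have := dist_triangle (x i) (y i) (z1 i); rewrite [dist (y i) (x i)]dist_sym (adj_dist xy) e => le.
  have xzD : dist (x i) (z1 i) = D.+1 by have := xz1 i; lia.
  split=> //; apply: geo_eq; rewrite ?[dist (y i) (x i)]dist_sym ?(adj_dist xy) //.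
  by rewrite e xzD.
have yz1 i : dist (y i) (z1 i) <= D.+2.
  have := dist_triangle (x i) (y i) (z1 i); have := xz1 i.
  by rewrite [dist (y i) (x i)]dist_sym; have := star_dist i ystar; lia.
have z2opt : opt g z2.
  apply: (push_opt ymin ydom z1opt _ yz1) => // i; rewrite ffunE.
  have [[/far[_ _ ->] _ -> _]|[_ -> _]] := H1 i; last exact: ystar.
  by left.
have z2P i : [/\ dist (x i) (z2 i) <= D.+1, dist (y i) (z2 i) <= D.+1 &
    col (x i) = c -> dist (y i) (z2 i) <= D].
  rewrite ffunE; have [[e cy _ ->]|[ne _ ->]] := H1 i.
    have [xy xzD xE] := far i e; split.
    - rewrite geo_sym e // -xE dist_geo ?e //; lia.
    - by have [_] := geo_spec (z1 i) (y i) 1; rewrite dist_sym [dist (z1 i) _]dist_sym; lia.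
    - by move=> cx; move: cy; rewrite (adj_col xy) cx; case: (c).
  split; first exact: xz1.
    have := yz1 i; rewrite leq_eqVlt => /orP[/eqP e|//].
    have [xy xzD _] := far i e; case: (ne e); rewrite (adj_col xy).
    have [yx|[_ -> _]] := step i; last by rewrite negbK.
    by move: xy; rewrite yx adj_irr.
  move=> cx; have [->|[_]] := step i; first exact: xz1c.
  by rewrite cx; case: (c).
(* Again [y] is only pushed back to [x]: where [y = x] has color [c] the distance is already at most
   [D], and at the other pushed coordinates parity puts [x] at distance [D] from [z2]. *)
pose z3 := prod_push D.+1 (c (+) odd D.+1) z2 y.
have H2 i := @push_cases D.+1 c (y i) (z2 i).
have z3opt : opt g z3.
  have yz2 i : dist (y i) (z2 i) <= D.+1 by have [] := z2P i.
  apply: (push_opt ymin ydom z2opt _ yz2) => // i; rewrite ffunE.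
  have [[e cy -> _]|[_ -> _]] := H2 i; last exact: ystar.
  have [xz2 _ yz2c] := z2P i; left.
  have [yx|[xy cx _]] := step i; first by have := yz2c; rewrite -yx cy e ltnn => /(_ erefl).
  have := odd_adj _ _ (z2 i) xy; have := dist_triangle (x i) (y i) (z2 i).
  rewrite [dist (y i) (x i)]dist_sym (adj_dist xy) e => le od.
  have xz2D : dist (x i) (z2 i) = D.
    move: xz2; rewrite leq_eqVlt => /orP[/eqP xe|]; last by lia.
    by move: od; rewrite xe; case: (odd _).
  by apply: geo_eq; rewrite ?[dist (y i) (x i)]dist_sym ?(adj_dist xy) // xz2D e.
have yz3 i : dist (y i) (z3 i) <= D.+1.
  rewrite ffunE; have [_ yz2 _] := z2P i; have [[e _ _ ->]|[_ _ ->]] := H2 i => //.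
  by have [_] := geo_spec (z2 i) (y i) 1; rewrite dist_sym [dist (z2 i) _]dist_sym; lia.
have yz3c i : col (y i) = c -> dist (y i) (z3 i) <= D.
  move=> cy; rewrite ffunE; have [_ yz2 _] := z2P i.
  have [[e _ _ ->]|[ne _ ->]] := H2 i.
    by have [_] := geo_spec (z2 i) (y i) 1; rewrite dist_sym [dist (z2 i) _]dist_sym; lia.
  by move: yz2; rewrite leq_eqVlt => /orP[/eqP/ne/(_ cy)|].
(* Coordinates of [y] of color [~~ c] have not moved from [x]; this round settles them and leaves
   those of color [c] alone. *)
have [z4 [z4opt _ yz4c z4E]] := push_round ymin ydom z3opt yz3.
exists z4 => // i; have [cy|ncy] := eqVneq (col (y i)) (~~ c); first exact: yz4c.
rewrite z4E; last exact/eqP.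
by apply: yz3c; case: (col _) (c) ncy => [] [].
Qed.

End Descent.

(** * Distance to the optimal set along an execution *)

Section Iterations.
Variables (T : bipartite_tree) (n : nat) (R : realType).
Variable g : {ffun 'I_n -> T} -> \bar R.
Hypotheses (g_ninfty : no_ninfty g) (g_convex : L_convex g).
Hypothesis opt_g : exists y, opt g y.
Implicit Types x y z : {ffun 'I_n -> T}.

Lemma dist_opt_attained x :
  exists2 z, opt g z & forall i, dist (x i) (z i) <= dist_opt g x.
Proof.
have [y yopt] := opt_g.
have [|[z zopt e] _] := @nat_minP
  [set k | exists2 y, opt g y & k = prod_dist y x] (prod_dist y x); first by exists y.
by exists z => // i; rewrite /dist_opt e dist_sym; exact: (@leq_bigmax _ (fun i => dist (z i) (x i))).
Qed.

Lemma dist_opt_le x z D :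
  opt g z -> (forall i, dist (x i) (z i) <= D) -> dist_opt g x <= D.
Proof.
move=> zopt xz; have [|_ /(_ (prod_dist z x))] := @nat_minP
  [set k | exists2 y, opt g y & k = prod_dist y x] (prod_dist z x); first by exists z.
move=> le; apply: leq_trans (le _) _; first by exists z.
by apply/bigmax_leqP => i _; rewrite dist_sym; exact: xz.
Qed.

Lemma dist_opt0 x : opt g x -> dist_opt g x = 0.
Proof.
by move=> xopt; apply/eqP; rewrite -leqn0 (dist_opt_le xopt) // => i; rewrite distuu.
Qed.

Lemma dist_opt_star c x y : star c x y ->
  dist_opt g x <= (dist_opt g y).+1 /\ dist_opt g y <= (dist_opt g x).+1.
Proof.
move=> xy; have xyi i := star_dist i xy.
have [z zopt yz] := dist_opt_attained y; have [w wopt xw] := dist_opt_attained x.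
split; [apply: (dist_opt_le zopt) => i|apply: (dist_opt_le wopt) => i].
  by have := dist_triangle (y i) (x i) (z i); have := xyi i; have := yz i; lia.
by have := dist_triangle (x i) (y i) (w i); rewrite [dist (y i) (x i)]dist_sym;
   have := xyi i; have := xw i; lia.
Qed.

Lemma dist_opt_step c x y : dom g x -> minimizer_on (star c x) g x ->
  minimizer_on (star (~~ c) x) g y -> dist_opt g y <= (dist_opt g x).-1 \/ opt g x.
Proof.
move=> xdom xmin ymin; have [z zopt xz] := dist_opt_attained x.
case E : (dist_opt g x) xz => [|D] xz /=.
  right; suff -> : x = z by [].
  by apply/ffunP => i; apply: dist0_eq; apply/eqP; rewrite -leqn0.
left; have [z' z'opt yz'] :=
  opt_closer_after_step g_ninfty g_convex xdom xmin ymin zopt xz.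
exact: dist_opt_le z'opt yz'.
Qed.

Lemma minimizer_on_star_self c x y :
  minimizer_on (star c x) g y -> minimizer_on (star c y) g y.
Proof.
move=> [xy ymin]; split; first exact: star_refl.
by move=> w yw; apply: ymin; apply: star_trans yw.
Qed.

Lemma minimizer_on_union c x y :
  minimizer_on (ideal x `|` filtr x) g y -> star c x y -> minimizer_on (star c x) g y.
Proof.
by rewrite (star_union c) => -[_ ymin] xy; split=> // w xw; apply: ymin; left.
Qed.

Lemma minimizer_on_dom A x y : A x -> minimizer_on A g y -> dom g x -> dom g y.
Proof.
by move=> Ax [_ ymin] xdom e; apply: xdom; apply/eqP; rewrite -leye_eq -e ymin.
Qed.

(* The color of the star over which an iterate is known to be minimal alternates
   along the execution. *)
Lemma sd_step c x y : dom g x -> minimizer_on (star c x) g x ->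
  minimizer_on (ideal x `|` filtr x) g y -> g x <> g y ->
  [/\ dom g y, minimizer_on (star (~~ c) y) g y &
      dist_opt g x = (dist_opt g y).+1].
Proof.
move=> xdom xmin ymin gxy.
have xU : (ideal x `|` filtr x) x by rewrite (star_union c); left; exact: star_refl.
have lt : (g y < g x)%E.
  rewrite lt_neqAle; case: ymin => _ /(_ x xU) ->; rewrite andbT.
  by apply/eqP => e; apply: gxy.
(* A strictly better point cannot lie in [star c x]. *)
have xy : star (~~ c) x y.
  case: (ymin); rewrite (star_union c) => -[] // xy _.
  by case: xmin => _ /(_ y xy); rewrite leNgt lt.
have ymin' := minimizer_on_union ymin xy.
split; [exact: minimizer_on_dom xU ymin xdom|exact: minimizer_on_star_self ymin'|].
(* The distance drops by at most one, and by at least one by [dist_opt_step]; distance 0 would make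
   [x] optimal, against [g y < g x]. *)
have [le _] := dist_opt_star xy.
have [le'|[_ /(_ y I)]] := dist_opt_step xdom xmin ymin'; last by rewrite leNgt lt.
case E : (dist_opt g x) le le' => [|D] //= le le'; last by apply/eqP; rewrite eqn_leq le.
have [z [_ zopt] xz] := dist_opt_attained x.
have xz' : x = z by apply/ffunP => i; apply: dist0_eq; apply/eqP; rewrite -leqn0 -E.
by have := zopt y I; rewrite -xz' leNgt lt.
Qed.

Lemma sd_updates_dist_opt c x m xs : dom g x -> minimizer_on (star c x) g x ->
  sd_updates g x m xs ->
  [/\ dom g (xs m), exists c', minimizer_on (star c' (xs m)) g (xs m) &
      dist_opt g x = m + dist_opt g (xs m)].
Proof.
move=> xdom xmin [x0 xs_step]; elim: m xs_step => [_|m ih xs_step].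
  by rewrite x0; split=> //; exists c.
have [|mdom [c' mmin] ->] := ih; first by move=> k km; apply: xs_step; apply: ltnW.
have [ymin gxy] := xs_step m (ltnSn m).
have [ydom ymin' ->] := sd_step mdom mmin ymin gxy.
by split=> //; [exists (~~ c')|rewrite addSnnS].
Qed.

(** Stopping makes [x] minimal over the opposite star too, so [dist_opt_step] applies with [y = x]:
    either [x] is optimal or its distance is at most its own predecessor. *)
Lemma sd_stops_opt c x : dom g x -> minimizer_on (star c x) g x -> sd_stops g x ->
  dist_opt g x = 0.
Proof.
move=> xdom xmin [y [_ ymin] gxy].
have xmin' : minimizer_on (star (~~ c) x) g x.
  split; first exact: star_refl.
  by move=> w xw; rewrite gxy; apply: ymin; rewrite (star_union c); right.
have [|/dist_opt0//] := dist_opt_step xdom xmin xmin'; lia.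
Qed.

End Iterations.

Theorem theorem2p6 (R : realType) (T : bipartite_tree) (n : nat)
    (g : {ffun 'I_n -> T} -> \bar R) (x : {ffun 'I_n -> T})
    (lfT : locally_finite T) (n_gt0 : 0 < n)
    (g_ninfty : no_ninfty g) (g_convex : L_convex g)
    (opt_g : exists y, opt g y) (dom_x : dom g x) :
  (forall m xs, sd_updates g x m xs -> m <= dist_opt g x + 2) /\
  (minimizer_on (filtr x) g x \/ minimizer_on (ideal x) g x ->
   forall m xs, sd_run g x m xs -> m = dist_opt g x).
Proof.
split=> [[//|m] xs [x0 xs_step]|xmin m xs [upd stop]].
  (* The first update may move away from [opt g] by one, but [xs 1] is minimal over one of its
     stars, so each of the [m] later updates gains one. The first update and this possible loss
     account for the constant 2. *)
  have [ymin _] := xs_step 0 isT; rewrite x0 in ymin.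
  have [c xy] : exists c, star c x (xs 1).
    by case: (ymin) => + _; rewrite (star_union true) => -[xy|xy]; eexists; exact: xy.
  have ymin' := minimizer_on_union ymin xy.
  have ydom := minimizer_on_dom (@star_refl _ _ c x) ymin' dom_x.
  have [|_ _ le] := @sd_updates_dist_opt _ _ _ _ g_ninfty g_convex opt_g c (xs 1) m
    (fun k => xs k.+1) ydom (minimizer_on_star_self ymin').
    by split=> // k km; apply: xs_step.
  by have [_] := dist_opt_star opt_g xy; lia.
have [c xmin'] : exists c, minimizer_on (star c x) g x.
  by case: xmin; [exists false; rewrite star_filtr|exists true; rewrite star_ideal].
have [mdom [c' mmin] ->] := sd_updates_dist_opt g_ninfty g_convex opt_g dom_x xmin' upd.
by rewrite (sd_stops_opt g_ninfty g_convex opt_g mdom mmin stop) addn0.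
Qed.
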